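(* Let $\mathcal R_i,\mathcal R_j$ ($i\neq j$) be two regions of interest. Let a nominal trajectory $\hat x_0,\dots,\hat x_L$ from $\mathcal R_i$ to $\mathcal R_j$, a polytope $\mathcal Z_{ij}$ and the numbers $\bar\varepsilon_0,\dots,\bar\varepsilon_L$ be given as in the context. Suppose that the tube optimization problem described in the context has a solution, providing optimal tubes $\mathcal X_0,\dots,\mathcal X_L$ and control sets $\mathcal U_0,\dots,\mathcal U_{L-1}$. Then the state is reachable from $\mathcal R_i$ to $\mathcal R_j$ (in the sense defined in the context) if the following two conditions hold: (D.1) $\mathcal R_i\subseteq \mathcal X_0$; (D.2) if $\mathcal X_{\ell'}\cap\mathcal R_j\neq\emptyset$ for $\ell'\in\{1,\dots,L-1\}$, then $\mathcal X_\ell\cap\mathcal R_i=\emptyset$ for all $\ell\in\{\ell',\dots,L-1\}$.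
   Context: **System.** The plant is $x_{k+1}=Ax_k+Bu_k+w_k$, $k\in\mathbb N=\{0,1,2,\dots\}$, with $x_k\in\mathbb R^n$, $u_k\in\mathcal U\subset\mathbb R^m$, $w_k\in\mathcal W\subset\mathbb R^n$, where $\mathcal U,\mathcal W$ are polytopes (convex hulls of finitely many points) containing the origin in their interiors. The free space $\mathcal X\subset\mathbb R^n$ is a polygonal set, possibly non-convex. The regions of interest $\mathcal R_1,\dots,\mathcal R_{N_I}\subset\mathcal X$ are pairwise disjoint polytopes. For $i\ne j$ put $\mathcal X_{ij}=\mathcal X\setminus\bigcup_{n\in\{1,\dots,N_I\}\setminus\{i,j\}}\mathcal R_n$. **Set operations.** $A\oplus B=\{x+y: x\in A,\ y\in B\}$ (a point is identified with the corresponding singleton), $A\ominus B=\{x: x+y\in A\ \forall y\in B\}$, and $\mathrm{co}$ denotes the convex hull. **Reachability.** The state is reachable from $\mathcal R_i$ to $\mathcal R_j$ ($i\neq j$) if there exists a finite integer $L\ge1$ such that for any $x_0\in\mathcal R_i$ and any disturbance sequence $w_0,\dots,w_{L-1}\in\mathcal W$ there exist $u_0,\dots,u_{L-1}\in\mathcal U$ such that the resulting trajectory $x_1,\dots,x_L$ of the plant satisfies: (C.1) $x_L\in\mathcal R_j$; (C.2) $x_\ell\in\mathcal X_{ij}$ for all $\ell\in\{0,\dots,L\}$; (C.3) if $x_{\ell'}\in\mathcal R_j$ for some $\ell'\in\{1,\dots,L\}$, then $x_\ell\notin\mathcal R_i$ for all $\ell\in\{\ell',\dots,L\}$. **Nominal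 trajectory.** $\hat x_0$ is the Chebyshev center of $\mathcal R_i$ (the center of a largest ball contained in $\mathcal R_i$); there are $\hat u_0,\dots,\hat u_{L-1}\in\mathcal U$ with $\hat x_{k+1}=A\hat x_k+B\hat u_k$ for $0\le k\le L-1$; the nominal states remain in $\mathcal X_{ij}$; and $\hat x_L\in\mathcal R_j$. Here $L\geq 1$. **Tubes.** $\mathcal Z_{ij}=\mathrm{co}\{z_1,\dots,z_p\}\subset\mathbb R^n$ is a given polytope containing the origin in its interior. For scalars $\varepsilon_\ell>0$, set $\mathcal X_\ell=\hat x_\ell\oplus\varepsilon_\ell\mathcal Z_{ij}=\mathrm{co}\{x_{\ell,1},\dots,x_{\ell,p}\}$ with $x_{\ell,s}=\hat x_\ell+\varepsilon_\ell z_s$, for $\ell\in\{0,\dots,L\}$. Let $\bar\varepsilon_\ell=\max\{\varepsilon>0:\hat x_\ell\oplus\varepsilon\mathcal Z_{ij}\subseteq\mathcal X_{ij}\}$. **Tube optimization problem.** Given $\hat x_0,\dots,\hat x_L$, $\bar\varepsilon_0,\dots,\bar\varepsilon_L$ and $\mathcal Z_{ij}$, choose $\varepsilon_0,\dots,\varepsilon_L>0$ and sets $\mathcal U_\ell=\mathrm{co}\{u_{\ell,1},\dots,u_{\ell,p}\}$, $\ell\in\{0,\dots,L\}$ (with $\mathcal U_L$ appearing in no constraint), to maximize $\varepsilon_0$ subject to - $\varepsilon_\ell\le\bar\varepsilon_\ell$ for all $\ell\in\{0,\dots,L\}$; - $\mathcal X_L\subseteq\mathcal R_j$; - $Ax_{\ell,s}+Bu_{\ell,s}\in\mathcal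 X_{\ell+1}\ominus\mathcal W$ and $u_{\ell,s}\in\mathcal U$ for all $\ell\in\{0,\dots,L-1\}$ and $s\in\{1,\dots,p\}$. *)

(* Defs.v *)
From HB Require Import structures.
From mathcomp Require Import all_boot all_order all_algebra.
From mathcomp Require Import all_classical all_reals all_analysis.

Set Implicit Arguments.
Unset Strict Implicit.
Unset Printing Implicit Defensive.

Import Order.TTheory GRing.Theory Num.Theory.
Import numFieldNormedType.Exports.

Local Open Scope classical_set_scope.
Local Open Scope ring_scope.

Section Sets.
Context {R : realType} {n : nat}.
Implicit Types (P Q S : set 'cV[R]_n) (c x : 'cV[R]_n) (r e : R).

Definition is_max (E : set R) (m : R) : Prop := E m /\ ubound E m.

Definition msum P Q : set 'cV[R]_n := [set x + y | x in P & y in Q].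

Definition pdiff P Q : set 'cV[R]_n := [set x | forall y, Q y -> P (x + y)].

Definition dilate e P : set 'cV[R]_n := [set e *: x | x in P].

Definition co S : set 'cV[R]_n :=
  smallest (fun K : set 'cV[R]_n => convex_set K) S.

Definition polytope P : Prop :=
  exists2 F : set 'cV[R]_n, finite_set F & P = co F.

(* A possibly unbounded intersection of finitely many closed half-spaces. *)
Definition polyhedron P : Prop :=
  exists (k : nat) (H : 'M[R]_(k, n)) (h : 'cV[R]_k),
    P = [set x | forall a, (H *m x) a 0 <= h a 0].

Definition polygonal S : Prop :=
  exists (k : nat) (P : 'I_k -> set 'cV[R]_n),
    (forall a, polyhedron (P a)) /\ S = \bigcup_(a in [set: 'I_k]) P a.

(* The norm of the library on matrices is the sup norm; the balls in the
   definition of the Chebyshev center are Euclidean. *)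
Definition norm2 x : R := Num.sqrt (\sum_(a < n) x a 0 ^+ 2).

Definition eball c r : set 'cV[R]_n := [set x | norm2 (x - c) <= r].

(* The largest ball need not be unique; any of its centers is allowed. *)
Definition chebyshev_center P c : Prop :=
  exists r, is_max [set r' | 0 <= r' /\ exists c', eball c' r' `<=` P] r
            /\ eball c r `<=` P.

End Sets.

Section System.
Context {R : realType} {n m N : nat}.
Variables (A : 'M[R]_n) (B : 'M[R]_(n, m)).
Variables (U : set 'cV[R]_m) (W : set 'cV[R]_n).
Variables (X : set 'cV[R]_n) (Reg : 'I_N -> set 'cV[R]_n).

Fixpoint trajectory (x0 : 'cV[R]_n) (u : nat -> 'cV[R]_m)
    (w : nat -> 'cV[R]_n) (k : nat) : 'cV[R]_n :=
  if k is k'.+1 then A *m trajectory x0 u w k' + B *m u k' + w k' else x0.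

Definition Xij (i j : 'I_N) : set 'cV[R]_n :=
  X `\` \bigcup_(k in [set k : 'I_N | k != i /\ k != j]) Reg k.

(* Finite sequences are given as functions on nat, of which only the relevant
   values are constrained.  The control sequence may depend on the whole
   disturbance sequence. *)
Definition reachable (i j : 'I_N) : Prop :=
  exists L : nat, (1 <= L)%N /\
    forall (x0 : 'cV[R]_n) (w : nat -> 'cV[R]_n),
      Reg i x0 -> (forall l, (l < L)%N -> W (w l)) ->
      exists u : nat -> 'cV[R]_m,
        (forall l, (l < L)%N -> U (u l)) /\
        let x := trajectory x0 u w in
        [/\ Reg j (x L),
            forall l, (l <= L)%N -> Xij i j (x l) &
            forall l', (1 <= l' <= L)%N -> Reg j (x l') ->
              forall l, (l' <= l <= L)%N -> ~ Reg i (x l)].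

Definition nominal_trajectory (i j : 'I_N) (L : nat) (xhat : nat -> 'cV[R]_n)
    : Prop :=
  [/\ chebyshev_center (Reg i) (xhat 0%N),
      exists uhat : nat -> 'cV[R]_m, forall k, (k < L)%N ->
        U (uhat k) /\ xhat k.+1 = A *m xhat k + B *m uhat k,
      forall l, (l <= L)%N -> Xij i j (xhat l) &
      Reg j (xhat L)].

Section Tubes.
Variables (i j : 'I_N) (L : nat) (xhat : nat -> 'cV[R]_n).
Variables (p : nat) (z : 'I_p -> 'cV[R]_n).

Definition tube (eps : nat -> R) (l : nat) : set 'cV[R]_n :=
  msum [set xhat l] (dilate (eps l) (co (range z))).

Definition tube_vertex (eps : nat -> R) (l : nat) (s : 'I_p) : 'cV[R]_n :=
  xhat l + eps l *: z s.

Definition max_scaling (l : nat) (e : R) : Prop :=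
  is_max [set e' : R | 0 < e' /\
            msum [set xhat l] (dilate e' (co (range z))) `<=` Xij i j] e.

(* The control set U_l is co {u l s : s}; it enters the constraints only
   through the points u l s, which are the decision variables. *)
Definition tube_feasible (ebar : nat -> R)
    (eps : nat -> R) (u : nat -> 'I_p -> 'cV[R]_m) : Prop :=
  [/\ forall l, (l <= L)%N -> 0 < eps l,
      forall l, (l <= L)%N -> eps l <= ebar l,
      tube eps L `<=` Reg j &
      forall l, (l < L)%N -> forall s,
        pdiff (tube eps l.+1) W (A *m tube_vertex eps l s + B *m u l s)
        /\ U (u l s)].

Definition tube_optimal (ebar : nat -> R)
    (eps : nat -> R) (u : nat -> 'I_p -> 'cV[R]_m) : Prop :=
  tube_feasible ebar eps u /\
  forall (eps' : nat -> R) (u' : nat -> 'I_p -> 'cV[R]_m),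
    tube_feasible ebar eps' u' -> eps' 0%N <= eps 0%N.

End Tubes.
End System.

(* Main.v *)
Require Import Defs.
From HB Require Import structures.
From mathcomp Require Import all_boot all_order all_algebra.
From mathcomp Require Import all_classical all_reals all_analysis.

Import Order.TTheory GRing.Theory Num.Theory.
Import numFieldNormedType.Exports.

Local Open Scope classical_set_scope.
Local Open Scope ring_scope.

(** The optimal tubes carry a feedback law.  Let the robust predecessor of a
    target [T] be the set of states from which one admissible control brings
    the plant into [T] whatever the disturbance.  Since the dynamics is affine
    in the pair (state, control), the robust predecessor of a convex set under
    a convex control set is convex: interpolating two states, one interpolates
    their controls, and the same disturbance enters both successors.

    Feasibility says that the vertices of the tube at time [l] lie in the
    robust predecessor of the tube at time [l + 1]; as the latter is convex,
    the whole tube does ([tube_sub_robust_pre]).  By (D.1) the run starts in the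
    first tube, hence choosing at each time a suitable control keeps it in the
    tubes up to time [L] ([robust_pre_chain]).

    It remains to read off the three conditions.  (C.1): the last tube is inside
    [R_j].  (C.2): a tube grows with its scaling, because its shape is convex
    and contains the origin, so it sits inside the tube of maximal scaling,
    which avoids the forbidden regions.  (C.3): at times before [L] this is
    (D.2), and at time [L] the state is in [R_j], which is disjoint from [R_i]. *)

Section Convexity.
Context {R : realType} {n : nat}.
Implicit Types (K S : set 'cV[R]_n) (c x y : 'cV[R]_n) (e t : R).

Lemma convex_setP K :
  convex_set (K : set (convex_lmodType 'cV[R]_n)) <->
  forall x y t, 0 <= t <= 1 -> K x -> K y -> K (t *: x + (1 - t) *: y).
Proof.
split => [cK x y t /andP[t0 t1] Kx Ky | cK x y t].
  by have := cK x y (Itv01 t0 t1); rewrite !inE; exact.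
by rewrite !inE; apply: cK; rewrite ge0 le1.
Qed.

Lemma convex_co S : convex_set (co S : set (convex_lmodType 'cV[R]_n)).
Proof.
apply/convex_setP => x y t t01 Sx Sy K KS.
have [/convex_setP cK _] := KS.
by apply: cK => //; [exact: Sx | exact: Sy].
Qed.

Lemma convex_polytope P :
  polytope P -> convex_set (P : set (convex_lmodType 'cV[R]_n)).
Proof. by move=> [F _ ->]; exact: convex_co. Qed.

Lemma msum_dilateP c e K x :
  Defs.msum [set c] (dilate e K) x <-> exists2 y, K y & x = c + e *: y.
Proof.
split => [[_ -> [_ [y Ky <-] <-]]|[y Ky ->]]; first by exists y.
by exists c => //; exists (e *: y) => //; exists y.
Qed.

Lemma convex_msum_dilate c e K :
  convex_set (K : set (convex_lmodType 'cV[R]_n)) ->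
  convex_set (Defs.msum [set c] (dilate e K) : set (convex_lmodType 'cV[R]_n)).
Proof.
move=> /convex_setP cK; apply/convex_setP.
move=> _ _ t t01 /msum_dilateP[x Kx ->] /msum_dilateP[y Ky ->].
apply/msum_dilateP.
exists (t *: x + (1 - t) *: y); first exact: cK.
rewrite !scalerDr addrACA -scalerDl subrKC scale1r.
by rewrite !scalerA ![e * _]mulrC.
Qed.

(** A convex set containing the origin is star-shaped about it, so its dilations
    are nested. *)
Lemma msum_dilate_le c e1 e2 K :
  convex_set (K : set (convex_lmodType 'cV[R]_n)) -> K 0 ->
  0 < e1 -> e1 <= e2 ->
  Defs.msum [set c] (dilate e1 K) `<=` Defs.msum [set c] (dilate e2 K).
Proof.
move=> /convex_setP cK K0 e1_gt0 e12 _ /msum_dilateP[y Ky ->].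
have e2_gt0 : 0 < e2 by exact: lt_le_trans e12.
apply/msum_dilateP; exists ((e1 / e2) *: y); last first.
  by rewrite scalerA mulrC divfK ?gt_eqF.
rewrite -[X in K X]addr0 -(scaler0 _ (1 - e1 / e2)); apply: cK => //.
by rewrite ler_pdivrMr // mul1r e12 andbT divr_ge0 // ltW.
Qed.

End Convexity.

Section RobustPredecessor.
Context {R : realType} {n m : nat}.
Variables (A : 'M[R]_n) (B : 'M[R]_(n, m)).
Variables (U : set 'cV[R]_m) (W : set 'cV[R]_n).
Implicit Types (T : set 'cV[R]_n).

Definition robust_pre T : set 'cV[R]_n :=
  [set x | exists2 v, U v & pdiff T W (A *m x + B *m v)].

(** The weights of a convex combination sum to 1, so the successor of the
    interpolated state under the interpolated control and a disturbance [w] is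
    the interpolation of the two successors under that same [w]. *)
Lemma convex_robust_pre T :
  convex_set (U : set (convex_lmodType 'cV[R]_m)) ->
  convex_set (T : set (convex_lmodType 'cV[R]_n)) ->
  convex_set (robust_pre T : set (convex_lmodType 'cV[R]_n)).
Proof.
move=> /convex_setP cU /convex_setP cT; apply/convex_setP.
move=> x y t t01 [v Uv Tv] [v' Uv' Tv'].
exists (t *: v + (1 - t) *: v'); first exact: cU.
move=> w Ww; have := cT _ _ _ t01 (Tv w Ww) (Tv' w Ww); congr T.
rewrite !mulmxDr -!scalemxAr !scalerDr [LHS]addrACA -scalerDl subrKC scale1r.
by rewrite [X in X + w]addrACA.
Qed.

(** The control is generated by the state feedback that picks an admissible
    input at each step, so it is even causal in the disturbance. *)
Lemma robust_pre_chain (L : nat) (T : nat -> set 'cV[R]_n) x0 w :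
  (forall l, (l < L)%N -> T l `<=` robust_pre (T l.+1)) ->
  T 0%N x0 -> (forall l, (l < L)%N -> W (w l)) ->
  exists u : nat -> 'cV[R]_m, (forall l, (l < L)%N -> U (u l)) /\
    forall l, (l <= L)%N -> T l (trajectory A B x0 u w l).
Proof.
move=> Tpre Tx0 Ww.
pose good l x : set 'cV[R]_m :=
  [set v | U v /\ pdiff (T l.+1) W (A *m x + B *m v)].
pose feedback l x := xget 0 (good l x).
have feedbackP l x : (l < L)%N -> T l x -> good l x (feedback l x).
  move=> lL Tx; have [v Uv Tv] := Tpre l lL x Tx.
  by apply: xgetPex; exists v.
pose fix closed_loop l := if l is l'.+1 then
  A *m closed_loop l' + B *m feedback l' (closed_loop l') + w l' else x0.
pose u l := feedback l (closed_loop l).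
have trajE l : trajectory A B x0 u w l = closed_loop l.
  by elim: l => //= l ->.
have Tloop l : (l <= L)%N -> T l (closed_loop l).
  elim: l => //= l IHl lL.
  have [_] := feedbackP l _ lL (IHl (ltnW lL)).
  by apply; exact: Ww.
exists u; split => l lL; last by rewrite trajE; exact: Tloop.
by have [] := feedbackP l _ lL (Tloop l (ltnW lL)).
Qed.

(** By convexity of the robust predecessor it is enough to steer the vertices,
    which is what the tube optimization problem asks for. *)
Lemma tube_sub_robust_pre (xhat : nat -> 'cV[R]_n) (p : nat)
    (z : 'I_p -> 'cV[R]_n) (eps : nat -> R) (l : nat) T :
  convex_set (U : set (convex_lmodType 'cV[R]_m)) ->
  convex_set (T : set (convex_lmodType 'cV[R]_n)) ->
  (forall s, robust_pre T (tube_vertex xhat z eps l s)) ->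
  tube xhat z eps l `<=` robust_pre T.
Proof.
move=> cU cT vertT _ /msum_dilateP[y zy ->].
have /convex_setP cP := convex_robust_pre T cU cT.
(* the pull-back of the robust predecessor to the coordinates of the shape *)
apply: (zy [set y | robust_pre T (xhat l + eps l *: y)]); split; last first.
  by move=> _ [s _ <-]; exact: vertT.
apply/convex_setP => a b t t01 /= Pa Pb.
have := cP _ _ _ t01 Pa Pb; congr (robust_pre T).
rewrite !scalerDr addrACA -scalerDl subrKC scale1r.
by rewrite !scalerA ![eps l * _]mulrC.
Qed.

End RobustPredecessor.

Theorem theorem1 (R : realType) (n m N : nat)
  (A : 'M[R]_n) (B : 'M[R]_(n, m))
  (U : set 'cV[R]_m) (W : set 'cV[R]_n)
  (X : set 'cV[R]_n) (Reg : 'I_N -> set 'cV[R]_n)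
  (U_polytope : polytope U) (U_int : interior U 0)
  (W_polytope : polytope W) (W_int : interior W 0)
  (X_polygonal : polygonal X)
  (Reg_polytope : forall k, polytope (Reg k))
  (Reg_sub : forall k, Reg k `<=` X)
  (Reg_disj : trivIset [set: 'I_N] Reg)
  (i j : 'I_N) (neq_ij : i <> j)
  (L : nat) (L_ge1 : (1 <= L)%N)
  (xhat : nat -> 'cV[R]_n)
  (xhat_nominal : nominal_trajectory A B U X Reg i j L xhat)
  (p : nat) (z : 'I_p -> 'cV[R]_n)
  (Z_int : interior (co (range z)) 0)
  (ebar : nat -> R)
  (ebar_max : forall l, (l <= L)%N -> max_scaling X Reg i j xhat z l (ebar l))
  (eps : nat -> R) (u : nat -> 'I_p -> 'cV[R]_m)
  (opt : tube_optimal A B U W Reg j L xhat z ebar eps u)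
  (D1 : Reg i `<=` tube xhat z eps 0)
  (D2 : forall l', (1 <= l' <= L.-1)%N ->
          tube xhat z eps l' `&` Reg j !=set0 ->
          forall l, (l' <= l <= L.-1)%N ->
            tube xhat z eps l `&` Reg i = set0) :
  reachable A B U W X Reg i j.
Proof.
have [[eps_gt0 eps_le tubeL tube_step] _] := opt.
have cZ := @convex_co R n (range z).
have tubes_linked l : (l < L)%N ->
    tube xhat z eps l `<=` robust_pre A B U W (tube xhat z eps l.+1).
  move=> lL; apply: tube_sub_robust_pre.
  - exact: convex_polytope.
  - exact: convex_msum_dilate.
  - by move=> s; have [? ?] := tube_step l lL s; exists (u l s).
have tube_free l : (l <= L)%N -> tube xhat z eps l `<=` Xij X Reg i j.
  move=> lL; have [[_ ebar_free] _] := ebar_max l lL.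
  apply: subset_trans ebar_free.
  apply: msum_dilate_le; [exact: cZ | | exact: eps_gt0 | exact: eps_le].
  exact: interior_subset Z_int.
exists L; split=> // x0 w Rx0 Ww.
have [v [Uv in_tube]] := robust_pre_chain A B U W L _ x0 w tubes_linked (D1 _ Rx0) Ww.
exists v; split=> //=.
have RjL := tubeL _ (in_tube L (leqnn L)).
split=> // [l lL | l' /andP[l'1 l'L] Rjl' l /andP[l'l lL] Ril].
  exact: tube_free (in_tube l lL).
move: lL; rewrite leq_eqVlt => /predU1P[lE | lL].
  apply: neq_ij; apply: (Reg_disj i j) => //.
  by exists (trajectory A B x0 v w L); split=> //; rewrite -lE.
have lL1 : (l <= L.-1)%N by rewrite -ltnS prednK.
have l'_hits_Rj : tube xhat z eps l' `&` Reg j !=set0.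
  by exists (trajectory A B x0 v w l'); split=> //; exact: in_tube.
have disj : tube xhat z eps l `&` Reg i = set0.
  by apply: D2 l'_hits_Rj _ _; rewrite ?l'1 ?l'l //= (leq_trans l'l).
suff : (tube xhat z eps l `&` Reg i) (trajectory A B x0 v w l).
  by rewrite disj.
by split=> //; apply: in_tube; exact: ltnW.
Qed.
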